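(* For every integer $n \ge 1$, let $M(n)$ denote the maximal length of a play of the ordered Zeckendorf game on $n$. Then $$M(n) \le \frac{n(n-1)}{2}.$$
   Context: The Fibonacci numbers are indexed by $F_1 = 1$, $F_2 = 2$, and $F_{i+1} = F_i + F_{i-1}$ for $i \ge 2$. The (two-player) ordered Zeckendorf game on $n$: a state is a finite ordered list (tuple) of Fibonacci numbers. The initial state is the list $(F_1, F_1, \dots, F_1)$ of $n$ copies of $F_1$. Players alternate turns; on each turn the player performs one of the following legal moves on two adjacent entries of the list (the other entries and their order being unchanged): (1) Merging: replace an adjacent pair $(F_i, F_{i+1})$ with the single entry $F_{i+2}$. (2) Merging ones: replace an adjacent pair $(F_1, F_1)$ with the single entry $F_2$. (3) Splitting: replace an adjacent pair $(F_i, F_i)$ with $(F_{i-2}, F_{i+1})$, for $i > 2$. (4) Splitting twos: replace an adjacent pair $(F_2, F_2)$ with $(F_1, F_3)$. (5) Switching: replace an adjacent pair $(F_i, F_j)$ with $(F_j, F_i)$ whenever $i > j$. The game ends when no legal move can be applied. The length of a play is the total number of moves made (by both players together). *)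

(* Defs.v *)
From mathcomp Require Import all_boot.

Set Implicit Arguments.
Unset Strict Implicit.
Unset Printing Implicit Defensive.

(* 1-based indexing F_1 = 1, F_2 = 2.  [fib 0] is a filler value: every rule
   below only uses indices i >= 1. *)
Fixpoint fib (i : nat) : nat :=
  if i is i1.+1 then (if i1 is i2.+1 then fib i1 + fib i2 else 1) else 1.

(* A state is the list of its entries (values, not indices). *)
Definition state := seq nat.

Definition initial_state (n : nat) : state := nseq n (fib 1).

(* [rewrites p q]: the adjacent pair p may be replaced by the entries q. *)
Inductive rewrites : seq nat -> seq nat -> Prop :=
| Merging i of 1 <= i :
    rewrites [:: fib i; fib i.+1] [:: fib i.+2]
| MergingOnes :
    rewrites [:: fib 1; fib 1] [:: fib 2]
| Splitting i of 2 < i :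
    rewrites [:: fib i; fib i] [:: fib (i - 2); fib i.+1]
| SplittingTwos :
    rewrites [:: fib 2; fib 2] [:: fib 1; fib 3]
| Switching i j of 1 <= j & j < i :
    rewrites [:: fib i; fib j] [:: fib j; fib i].

Definition legal_move (s t : state) : Prop :=
  exists a b p q : seq nat,
    [/\ rewrites p q, s = a ++ p ++ b & t = a ++ q ++ b].

Definition game_over (s : state) : Prop := forall t, ~ legal_move s t.

(* [play s m]: some play starting from s reaches the end of the game after
   exactly m moves.  The rules are the same for both players, so whose turn it
   is need not be recorded. *)
Inductive play : state -> nat -> Prop :=
| PlayEnd s of game_over s : play s 0
| PlayMove s t m of legal_move s t & play t m : play s m.+1.

Definition infinite_play (s : state) (u : nat -> state) : Prop :=
  u 0 = s /\ forall k, legal_move (u k) (u k.+1).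

(* M = M(n).  The last clause rules out plays of infinite length, which [play]
   does not see. *)
Definition maximal_length (n M : nat) : Prop :=
  [/\ play (initial_state n) M,
      forall m, play (initial_state n) m -> m <= M
    & ~ exists u, infinite_play (initial_state n) u].

(* Main.v *)
Require Import Defs.
From mathcomp Require Import all_boot zify.
From Stdlib Require Import Classical.

(** Weigh an ordered pair of entries (F_i, F_j), with F_i to the left of F_j, by
    min(i, j + 1), and let the potential of a state be the total weight of its
    pairs of entries.  The initial state has n(n-1)/2 pairs, each of weight
    min(1, 2) = 1, so it suffices that every move lowers the potential.

    When one of the two entries of a pair is fixed, the weight has the form
    i |-> min(i, c) or j |-> min(c, j + 1) in the index of the other.  Such a
    function is nondecreasing and concave, so a split, which replaces two indices
    i by i - 2 and i + 1, does not raise its total; and it grows slowly enough for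
    merges not to raise it either.
    Hence the pairs formed with entries outside the move never gain
    weight ([cross_rewrites_r], [cross_rewrites_l]).  The pair on which the move
    acts loses weight ([potential_rewrites]): a merge destroys a pair, of positive
    weight; a split turns the weight i into i - 2, or 2 into 1; and a switch of
    i > j turns j + 1 into j.

    Thus the potential bounds the length of every play and excludes infinite ones;
    as every state admits some complete play, a longest one exists. *)

(** * Indices of Fibonacci numbers *)

Lemma fib_rec i : fib i.+2 = fib i.+1 + fib i.
Proof. by []. Qed.

Lemma fib_gt0 i : 0 < fib i.
Proof.
suff /andP[] : (0 < fib i) && (0 < fib i.+1) by [].
by elim: i => // i /andP[fi fi1]; rewrite fi1 fib_rec addn_gt0 fi1.
Qed.

Lemma fib_ltS i : fib i.+1 < fib i.+2.
Proof. by rewrite fib_rec -[ltnLHS]addn0 ltn_add2l fib_gt0. Qed.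

Lemma leq_fib i : i <= fib i.
Proof.
case: i => // i; elim: i => // i IH.
exact: leq_ltn_trans IH (fib_ltS i).
Qed.

Lemma fibS_inj : injective (fun k => fib k.+1).
Proof.
have fib_mono : {homo (fun k => fib k.+1) : i j / i < j}.
  by apply: homo_ltn => [? ? ?|i]; [exact: ltn_trans | exact: fib_ltS].
move=> i j eq_fib; case: (ltngtP i j) => // /fib_mono; by rewrite eq_fib ltnn.
Qed.

(** Searching among the first [x] Fibonacci numbers suffices because [i <= fib i].
    Numbers that are not Fibonacci get an index too, so that the potential is
    defined, and decreases, on states that need not come from a game. *)
Definition fib_index (x : nat) : nat :=
  (index x (mkseq (fun k => fib k.+1) x)).+1.

Lemma fibK i : 0 < i -> fib_index (fib i) = i.
Proof.
case: i => // i _; rewrite /fib_index.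
set s := mkseq _ _.
have lt_is : i < size s by rewrite size_mkseq leq_fib.
have {1}-> : fib i.+1 = nth 0 s i by rewrite nth_mkseq // leq_fib.
by rewrite index_uniq //; apply: mkseq_uniq; exact: fibS_inj.
Qed.

(** * The potential *)

Definition weight (x y : nat) : nat := minn (fib_index x) (fib_index y).+1.

Definition cross (s t : state) : nat := \sum_(x <- s) \sum_(y <- t) weight x y.

Fixpoint potential (s : state) : nat :=
  if s is x :: s' then cross [:: x] s' + potential s' else 0.

Lemma cross_consl x s t : cross (x :: s) t = cross [:: x] t + cross s t.
Proof. by rewrite /cross big_cons big_seq1. Qed.

Lemma cross_catl s1 s2 t : cross (s1 ++ s2) t = cross s1 t + cross s2 t.
Proof. exact: big_cat. Qed.

Lemma cross_catr s t1 t2 : cross s (t1 ++ t2) = cross s t1 + cross s t2.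
Proof.
by rewrite /cross -big_split; apply: eq_bigr => x _; rewrite big_cat.
Qed.

Lemma potential_cat s t :
  potential (s ++ t) = potential s + cross s t + potential t.
Proof.
elim: s => [|x s IH] /=; first by rewrite /cross big_nil.
by rewrite IH cross_catr [cross (x :: s) t]cross_consl; lia.
Qed.

Lemma potential_nseq n x :
  potential (nseq n x) = weight x x * 'C(n, 2).
Proof.
elim: n => [|n IH] /=; first by rewrite muln0.
by rewrite IH /cross big_seq1 big_nseq iter_addn_0 binS bin1 -mulnDr addnC.
Qed.

(** * Moves lower the potential *)

Lemma potential_pair x y : potential [:: x; y] = weight x y.
Proof. by rewrite /= /cross !big_cons !big_nil !addn0. Qed.

Lemma potential_rewrites p q : rewrites p q -> potential q < potential p.
Proof.
have potential1 x : potential [:: x] = 0 by rewrite /= /cross big_seq1 big_nil.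
by case=> *; rewrite ?potential_pair ?potential1 /weight !fibK; lia.
Qed.

(** Seen from an entry of index [c] on its left, an entry of index [j] weighs
    [minn c j.+1].  By concavity the step from [i] to [i + 1] adds at most what the
    two steps from [i - 2] to [i] add, which settles splits; merges only need
    [i + 3 <= (i + 1) + (i + 2)], or [3 <= 2 + 2] for a pair of ones. *)
Lemma cross_rewrites_r p q s : rewrites p q -> cross s q <= cross s p.
Proof.
move=> pq; apply: leq_sum => x _.
by case: pq => *; rewrite !big_cons big_nil /weight !fibK; lia.
Qed.

(** Seen from the right, the weight is [minn j c], and the same concavity argument
    applies; merges now use [i + 2 <= i + (i + 1)], where [1 <= i], or [2 <= 1 + 1]. *)
Lemma cross_rewrites_l p q s : rewrites p q -> cross q s <= cross p s.
Proof.
move=> pq; rewrite /cross exchange_big [leqRHS]exchange_big /=.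
apply: leq_sum => y _.
by case: pq => *; rewrite !big_cons big_nil /weight !fibK; lia.
Qed.

Lemma legal_move_potential s t : legal_move s t -> potential t < potential s.
Proof.
move=> [a [b [p [q [pq -> ->]]]]].
rewrite !potential_cat !cross_catr.
have := potential_rewrites p q pq.
have := cross_rewrites_r p q a pq.
have := cross_rewrites_l p q b pq.
lia.
Qed.

(** * Plays *)

Lemma play_leq_potential s m : play s m -> m <= potential s.
Proof.
elim=> // {}s t {}m /legal_move_potential lt_ts _ le_mt.
exact: leq_ltn_trans le_mt lt_ts.
Qed.

Lemma no_infinite_play s : ~ exists u, infinite_play s u.
Proof.
move=> [u [u0 move_u]].
have drop k : potential (u k) + k <= potential s.
  elim: k => [|k IH]; first by rewrite u0 addn0.
  by have := legal_move_potential _ _ (move_u k); lia.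
by have := drop (potential s).+1; lia.
Qed.

Lemma play_exists s : exists m, play s m.
Proof.
have [k] := ubnP (potential s); elim: k s => // k IH s le_sk.
have [[t move_st]|over] := classic (exists t, legal_move s t).
  have [|m play_t] := IH t.
    exact: leq_trans (legal_move_potential _ _ move_st) le_sk.
  by exists m.+1; exact: PlayMove move_st play_t.
by exists 0; apply: PlayEnd => t move_st; apply: over; exists t.
Qed.

Lemma bounded_nat_max (P : nat -> Prop) B :
    (exists m, P m) -> (forall m, P m -> m <= B) ->
  exists2 M, P M & forall m, P m -> m <= M.
Proof.
elim: B => [|B IH] [m0 Pm0] leB.
  by exists m0 => // m /leB; rewrite leqn0 => /eqP->.
have [PB|nPB] := classic (P B.+1); first by exists B.+1.
apply: IH => [|m Pm]; first by exists m0.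
have := leB m Pm; rewrite leq_eqVlt => /orP[/eqP eq_m|//].
by case: nPB; rewrite -eq_m.
Qed.

Theorem theorem1p5 (n : nat) (hn : 1 <= n) :
  exists M : nat, maximal_length n M /\ M <= (n * (n - 1)) %/ 2.
Proof.
have [M playM maxM] := bounded_nat_max (play (initial_state n)) _
  (play_exists _) (play_leq_potential _).
exists M; split; first by split=> //; exact: no_infinite_play.
have := play_leq_potential _ _ playM.
by rewrite potential_nseq /weight fibK // mul1n bin2 -divn2 subn1.
Qed.
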